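(* For every finite nonempty set $S\subset\mathbb{R}^2$ of points in general position there exists a plane straight-line spanning path of $S$ that is $\frac{5\pi}{4}$-open.
   Context: A finite set $S\subset\mathbb{R}^2$ is in general position if no three of its points are collinear. A plane straight-line graph $G=(S,E)$ on $S$ has vertex set $S$, its edges are straight-line segments connecting two points of $S$, and two edges do not intersect except possibly at common endpoints. A plane straight-line spanning path of $S$ is a plane straight-line graph on $S$ that is a path visiting every point of $S$ exactly once. The incident angles of $p\in S$ in $G$ are the angles between two edges of $G$ that appear consecutively in the circular order of the edges incident to $p$ (so a vertex of degree two has two incident angles, summing to $2\pi$). The openness $\mathrm{op}_G(p)$ of $p$ in $G$ is the maximum incident angle of $p$ in $G$; if $p$ has degree at most one, set $\mathrm{op}_G(p)=2\pi$. The openness of $G$ is $\mathrm{op}(G)=\min_{p\in S}\mathrm{op}_G(p)$, and $G$ is called $\varphi$-open if $\mathrm{op}(G)\ge\varphi$. *)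

(* Defs.v *)
From HB Require Import structures.
From mathcomp Require Import all_boot all_order all_algebra.
From mathcomp Require Import finmap.
From mathcomp Require Import all_classical all_reals all_analysis.

Set Implicit Arguments.
Unset Strict Implicit.
Unset Printing Implicit Defensive.

Import Order.TTheory GRing.Theory Num.Theory.
Local Open Scope ring_scope.

Section PlaneGeometry.
Variable R : realType.
Implicit Types (p q r u v x : R * R).

Definition dot u v : R := u.1 * v.1 + u.2 * v.2.

Definition cross u v : R := u.1 * v.2 - u.2 * v.1.

(* The library's norm on R * R is the sup norm. *)
Definition enorm u : R := Num.sqrt (dot u u).

Definition collinear p q r : Prop :=
  exists a b c : R, (a, b) != 0 /\
    forall x, x \in [:: p; q; r] -> a * x.1 + b * x.2 = c.

Definition segment p q : set (R * R) :=
  [set x | exists2 t : R, 0 <= t <= 1 & x = (1 - t) *: p + t *: q].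

(* For nonzero u and v: the angle in [0, 2 pi[ of the counterclockwise rotation
   that takes the direction of u to the direction of v. *)
Definition ccw_angle u v : R :=
  let a := acos (dot u v / (enorm u * enorm v)) in
  if 0 <= cross u v then a else 2 * pi - a.

Definition general_position (S : {fset R * R}) : Prop :=
  forall p q r, p \in S -> q \in S -> r \in S ->
    p != q -> q != r -> p != r -> ~ collinear p q r.

End PlaneGeometry.

(* A graph on S is given by its adjacency relation e on the finite type of the
   points of S; the edge {p, q} is drawn as the segment from val p to val q. *)
Section Graphs.
Variables (R : realType) (S : {fset R * R}).
Implicit Types (e : rel S) (p q r t : S).

Definition plane_straight_line_graph e : Prop :=
  [/\ symmetric e, irreflexive e &
      forall a b c d : S, e a b -> e c d -> [set a; b]%SET != [set c; d]%SET ->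
      forall x : R * R, segment (val a) (val b) x ->
                        segment (val c) (val d) x ->
        x \in [:: val a; val b] /\ x \in [:: val c; val d]].

Definition spanning_path e : Prop :=
  exists s : seq S, [/\ uniq s, forall p, p \in s &
    forall p q, e p q = infix [:: p; q] s || infix [:: q; p] s].

Definition plane_spanning_path e : Prop :=
  plane_straight_line_graph e /\ spanning_path e.

Definition angle_at p q r : R := ccw_angle (val q - val p) (val r - val p).

(* pr is the edge that follows pq in the counterclockwise circular order of the
   edges incident to p. *)
Definition consecutive e p q r : bool :=
  [&& e p q, e p r, q != r &
      [forall t, e p t ==> ~~ (0 < angle_at p q t < angle_at p q r)]].

Definition degree e p : nat := #|[pred q | e p q]|.

(* Angles are nonnegative and at least one consecutive pair exists when
   the degree is at least two, so the default 0 does not affect the maximum. *)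
Definition vertex_openness e p : R :=
  if (degree e p <= 1)%N then 2 * pi
  else \big[Num.max/0]_(qr : S * S | consecutive e p qr.1 qr.2)
         angle_at p qr.1 qr.2.

(* No vertex openness exceeds 2 pi, so for nonempty S the default 2 pi does not
   affect the minimum. *)
Definition openness e : R := \big[Num.min/2 * pi]_(p : S) vertex_openness e p.

Definition angle_open (phi : R) e : Prop := phi <= openness e.

End Graphs.

(* Main.v *)
Require Import Defs.
From HB Require Import structures.
From mathcomp Require Import all_boot all_order all_algebra.
From mathcomp Require Import finmap.
From mathcomp Require Import all_classical all_reals all_analysis.
From mathcomp Require Import ring lra.
Import Order.TTheory GRing.Theory Num.Theory.
Local Open Scope ring_scope.

(**
An inner vertex of a path is (5 pi / 4)-open iff the convex angle at it is at
most 3 pi / 4; call such a path gentle. Two statements are proved by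
simultaneous induction on |S|: (V) for every extreme point q of S there is a
gentle plane spanning path starting at q; (E) for every hull edge q1 q2 of S
there is one starting with q1 q2 or with q2 q1.

(V) Among the edges of the hull of S \ {q} that are visible from q choose yz with
y nearest to q, so that the angle at z in the triangle qyz is acute. If the angle
at y is at most 3 pi / 4, prepend q to a path given by (E) for yz. Otherwise let p
be the other hull neighbour of y. If yp is visible and the angle qyp is at most
3 pi / 4, use (E) for yp. In the remaining cases the hull angle zyp is at most
pi / 2, and q, z followed by a path given by (V) for y in S \ {q, z} is gentle.

(E) If all points see q1 q2 under an angle of at most 3 pi / 4 at q2 (or at q1),
use (V) for S without the other endpoint. Otherwise place q1 q2 on the x-axis
below K = S \ {q1, q2}. Points under wide angles exist on both sides, so every edge
of the lower hull of K over the strip of q1 q2 has slope strictly between -1 and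
1. Let v be the lowest point of K. If v is outside the strip or not below both
diagonals of the strip, some edge ab of K over the strip is visible from both q1
and q2, and (E) for ab in K extends to q1 q2 a b or to q2 q1 b a. Otherwise take the
edge ab of the lower hull of K \ {v} above v and extend to q1 q2 v b a or to
q2 q1 v a b.
*)

Set Implicit Arguments.
Unset Strict Implicit.
Unset Printing Implicit Defensive.

(** * Signed areas and extreme directions *)

Section Extremes.
Variable R : realType.
Implicit Types (p q r u v w x : R * R).

Lemma exists_argmin (T : eqType) (s : seq T) (P : T -> Prop) (f : T -> R) (x0 : T) :
  x0 \in s -> P x0 ->
  exists x : T, [/\ x \in s, P x & forall y : T, y \in s -> P y -> f x <= f y].
Proof.
elim: s x0 => // a s IH x0 x0s Px0.
have [[x1 x1s Px1]|nos] := pselect (exists2 x : T, x \in s & P x).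
  have [x [xs Px xmin]] := IH _ x1s Px1.
  have [[Pa fax]|na] := pselect (P a /\ f a <= f x).
    exists a; split=> //; first by rewrite mem_head.
    move=> y /[!inE] /predU1P[-> //|ys Py].
    exact: le_trans fax (xmin _ ys Py).
  exists x; split=> //; first by rewrite inE xs orbT.
  move=> y /[!inE] /predU1P[-> Pa|]; last exact: xmin.
  by have [//|/ltW fax] := leP (f x) (f a); case: na.
exists x0; split=> // y; move: x0s; rewrite !inE.
move=> /predU1P[->|x0s]; last by case: nos; exists x0.
by case/predU1P => [-> //|ys Py]; case: nos; exists y.
Qed.

(** Twice the signed area of the triangle, positive for a counterclockwise turn. *)
Definition area p q r : R := cross (q - p) (r - p).

Lemma areaE p q r :
  area p q r = (q.1 - p.1) * (r.2 - p.2) - (q.2 - p.2) * (r.1 - p.1).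
Proof. by []. Qed.

Lemma areaC p q r : area p q r = - area q p r.
Proof. rewrite !areaE; ring. Qed.

Lemma area_id p q : area p q q = 0.
Proof. rewrite areaE; ring. Qed.

Lemma crossZ (c : R) u v : cross (c *: u) v = c * cross u v.
Proof. by rewrite mulrBr !mulrA. Qed.

(** Seen from [y], all points lie strictly to the left of the direction [w], so [dot] over [cross]
    is the cotangent of the angle from [w] and decreases with it. The sign of [c] selects the last
    or the first direction. *)
Lemma exists_angular_extreme (T : seq (R * R)) y w x0 (c : R) :
  x0 \in T -> (forall x, x \in T -> 0 < cross w (x - y)) ->
  exists2 p, p \in T & forall x, x \in T -> 0 <= c * area y x p.
Proof.
move=> x0T wT.
have [p [pT _ pmin]] := exists_argmin (P := fun=> True)
  (fun x => c * (dot w (x - y) / cross w (x - y))) x0T I.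
exists p => // x xT.
have := pmin x xT I; have := wT x xT; have := wT p pT.
rewrite !mulrA => wp wx; rewrite ler_pdivrMr // mulrAC ler_pdivlMr //.
rewrite areaE; move: wp wx; rewrite /cross /dot /=.
set a := x.1 - y.1; set b := x.2 - y.2; set a' := p.1 - y.1; set b' := p.2 - y.2.
move=> wp wx le.
have w0 : 0 < w.1 ^+ 2 + w.2 ^+ 2.
  rewrite lt_neqAle addr_ge0 ?sqr_ge0 // andbT eq_sym paddr_eq0 ?sqr_ge0 //.
  rewrite !sqrf_eq0; apply/negP => /andP[/eqP w1 /eqP w2].
  by move: wp; rewrite w1 w2 !mul0r subrr ltxx.
(* Up to [c], the cross-multiplied cotangents differ by the squared length of [w] times the area. *)
rewrite -(pmulr_rge0 _ w0); lra.
Qed.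

End Extremes.

(** * Edges of the lower hull over a given abscissa *)

Section LowerEdges.
Variables (R : realType) (T : eqType) (X Y : T -> R).
Implicit Types (a b v x : T) (K : seq T).

(** The signed area in the coordinates [X], [Y]. The third point is free, so that [(0, 0)] and
    [(L, 0)] can be inserted. *)
Definition height a b (s t : R) : R :=
  (X b - X a) * (t - Y a) - (Y b - Y a) * (s - X a).

(** Among the pairs on both sides of [s], one is taken whose segment crosses a vertical line at the
    least ordinate [h]. A point below its line could replace [a] or [b] and lower the crossing. *)
Lemma exists_lower_edge K (s : R) a0 b0 :
  a0 \in K -> b0 \in K -> X a0 <= s < X b0 ->
  exists a b, [/\ a \in K, b \in K, X a <= s < X b &
    forall x, x \in K -> 0 <= height a b (X x) (Y x)].
Proof.
move=> a0K b0K /andP[a0s sb0].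
have [m [mK sm mmin]] := exists_argmin (P := fun x => s < X x) X b0K sb0.
(* No abscissa of a point lies in []s, s']], so each pair has its points strictly on both sides of
   [s']. *)
pose s' := (s + X m) / 2.
have ss' : s < s' by rewrite /s'; lra.
have s'm : s' < X m by rewrite /s'; lra.
pose P (ab : T * T) := X ab.1 <= s /\ s < X ab.2.
pose h (ab : T * T) := (Y ab.1 * (X ab.2 - s') + Y ab.2 * (s' - X ab.1)) / (X ab.2 - X ab.1).
have ab0K : (a0, b0) \in [seq (a, b) | a <- K, b <- K] by apply: allpairs_f.
have [[a b] [/allpairsP[[a1 b1] [aK bK [-> ->]]] [/= as_ sb] abmin]] :=
  exists_argmin (P := P) h ab0K (conj a0s sb0).
exists a1, b1; split=> //; first by apply/andP.
move=> x xK; rewrite /height /=.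
have bm := mmin b1 bK sb.
have [xs|sx] := leP (X x) s.
  have := abmin (x, b1) (allpairs_f _ xK bK) (conj xs sb).
  rewrite /h /= ler_pdivrMr; last by rewrite subr_gt0; lra.
  rewrite mulrAC ler_pdivlMr; last by rewrite subr_gt0; lra.
  move=> H.
  have bs : 0 < X b1 - s' by lra.
  rewrite -(pmulr_rge0 _ bs); lra.
have xm := mmin x xK sx.
have := abmin (a1, x) (allpairs_f _ aK xK) (conj as_ sx).
rewrite /h /= ler_pdivrMr; last by rewrite subr_gt0; lra.
rewrite mulrAC ler_pdivlMr; last by rewrite subr_gt0; lra.
move=> H.
have bs : 0 < s' - X a1 by lra.
rewrite -(pmulr_rge0 _ bs); lra.
Qed.
End LowerEdges.

(** * Lower hulls over a strip *)

Section Strip.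
Variables (R : realType) (T : eqType) (L : R).
Implicit Types (X Y : T -> R) (a b v x : T) (K : seq T).

(* In the applications [q1] and [q2] have coordinates [(0, 0)] and [(L, 0)]. *)
Definition lower_edge X Y K a b : Prop :=
  X a < X b /\ forall x, x \in K -> 0 <= height X Y a b (X x) (Y x).

Definition moderate X Y a b : Prop :=
  - (X b - X a) < Y b - Y a < X b - X a.

(* An edge [ab] of the lower hull that permits both prefixes [q1 q2 a b] and
   [q2 q1 b a]. *)
Definition visible_edge X Y K : Prop :=
  exists a b, [/\ a \in K, b \in K, lower_edge X Y K a b, moderate X Y a b &
    [/\ X a <= L, 0 <= X b, height X Y a b 0 0 < 0 & height X Y a b L 0 < 0]].

(* A lowest vertex [v] and an edge [ab] of the lower hull of the other points
   that permit both prefixes [q1 q2 v b a] and [q2 q1 v a b]. *)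
Definition edge_behind_vertex X Y K : Prop :=
  exists v a b, [/\ v \in K, a \in K, b \in K &
    [/\ a != v, b != v, lower_edge X Y [seq x <- K | x != v] a b,
    moderate X Y a b & [/\ 0 <= X v <= L, Y v <= X v, Y v <= L - X v,
      X a <= X v <= X b &
      (forall x, x \in K -> Y v <= Y x) /\ height X Y a b (X v) (Y v) <= 0]]].

Lemma height_mirror X Y a b x (s t : R) :
  height (fun x => L - X x) Y b a s t = height X Y a b (L - s) t.
Proof. rewrite /height; ring. Qed.

Lemma lower_edge_mirror X Y K a b :
  lower_edge (fun x => L - X x) Y K a b -> lower_edge X Y K b a.
Proof.
move=> [ab H]; split; first lra.
by move=> x /H; rewrite height_mirror // subKr.
Qed.

Lemma visible_edge_mirror X Y K :
  visible_edge (fun x => L - X x) Y K -> visible_edge X Y K.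
Proof.
move=> [a [b [aK bK /lower_edge_mirror ba m [aL b0]]]].
rewrite !height_mirror // subr0 subrr => hL h0.
exists b, a; split=> //; first by move: m; rewrite /moderate; lra.
by split=> //; lra.
Qed.

(* The point [l] lies below the diagonal [Y = - X] and [r] lies below the
   diagonal [Y = X - L]; neither can lie below the line [ab]. *)
Lemma moderate_lower_edge X Y K a b (l r : T) :
  (forall x, x \in K -> 0 < Y x) -> a \in K -> b \in K -> lower_edge X Y K a b ->
  X a <= L -> 0 <= X b ->
  l \in K -> X l + Y l < 0 -> r \in K -> L + Y r < X r -> moderate X Y a b.
Proof.
move=> Y0 aK bK [ab le] aL b0 lK lb rK rb.
have := le l lK; have := le r rK; rewrite /height /moderate.
have := Y0 a aK; have := Y0 b bK; have := Y0 l lK; have := Y0 r rK.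
move: (X a) (X b) (X l) (X r) (Y a) (Y b) (Y l) (Y r) ab aL b0 lb rb.
move=> xa xb xl xr ya yb yl yr ab aL b0 lb rb yr0 yl0 yb0 ya0 hr hl.
apply/andP; split.
(* With a slope of at most -1 the line would stay above [Y = - X] to the left of [b], hence above
   [l]. *)
- rewrite ltNge; apply/negP => h.
  have : 0 <= ((xb - xa) + (yb - ya)) * (xl - xb) by apply: mulr_le0; lra.
  nra.
- rewrite ltNge; apply/negP => h.
  have : 0 <= ((yb - ya) - (xb - xa)) * (xr - xa) by apply: mulr_ge0; lra.
  nra.
Qed.

(* Up to the mirror symmetry [X |-> L - X], these are all positions of a lowest
   point [v] except those below both diagonals [Y = X] and [Y = L - X]. *)
Lemma strip_dichotomy_half X Y K v (l r : T) :
  (forall x, x \in K -> 0 < Y x) -> v \in K ->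
  (forall x, x \in K -> Y v <= Y x) ->
  l \in K -> X l + Y l < 0 -> r \in K -> L + Y r < X r -> 0 < L ->
  L < X v \/ 0 <= X v <= L /\ X v < Y v ->
  visible_edge X Y K.
Proof.
move=> Y0 vK vmin lK lb rK rb L0 vX.
have Yl := Y0 l lK; have Yr := Y0 r rK.
(* The edge is taken over [v], or over the right end of the strip if [v] is beyond it. *)
pose s := Num.min (X v) L.
have ls : X l <= s < X r.
  rewrite /s; case: (leP (X v) L) vX => vX vC; case: vC => [|[]]; lra.
have [a [b [aK bK asb le]]] := exists_lower_edge Y lK rK ls.
have ab : X a < X b by lra.
have aL : X a <= L by move: asb; rewrite /s; case: (leP (X v) L); lra.
have b0 : 0 <= X b.
  by move: asb; rewrite /s; case: (leP (X v) L) vX => ?; case=> [|[]]; lra.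
have lab : lower_edge X Y K a b by split.
have m := moderate_lower_edge Y0 aK bK lab aL b0 lK lb rK rb.
(* As [v] is lowest and not below the line, the line cannot ascend when [v] is beyond the strip;
   otherwise the edge contains [v], which forces [a] down to the ordinate of [v]. *)
have slope : L < X v /\ X a <= L < X b /\ Y b <= Y a \/
    [/\ X a <= X v <= L, X v < X b, Y a = Y v & X v < Y v].
  move: (le v vK) (vmin a aK) (vmin b bK) asb m; rewrite /height /moderate /s.
  move: (X a) (X b) (X v) (Y a) (Y b) (Y v) ab vX => xa xb xv ya yb yv ab vX.
  move=> hv va vb; case: (leP xv L) => vL asb m; last first.
    left; split=> //; split=> //; rewrite leNgt; apply/negP => yab.
    have : 0 < (yb - ya) * (xv - xa) by apply: mulr_gt0; lra.
    have : 0 <= (xb - xa) * (ya - yv) by apply: mulr_ge0; lra.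
    lra.
  right; case: vX => [|[vX vY]]; first lra.
  split=> //; try lra.
  have : 0 <= (xv - xa) * (yb - yv) by apply: mulr_ge0; lra.
  move=> h; apply/eqP; rewrite eq_le va andbT leNgt; apply/negP => yav.
  have : 0 < (xb - xv) * (ya - yv) by apply: mulr_gt0; lra.
  lra.
have Ya := Y0 a aK; have Yb := Y0 b bK; have yvb := vmin b bK.
exists a, b; split=> //; split=> //; move: m slope; rewrite /height /moderate.
all: move: (X a) (X b) (X v) (Y a) (Y b) (Y v) ab aL b0 Ya Yb yvb.
all: move=> xa xb xv ya yb yv ab aL b0 Ya Yb yvb m slope.
- case: slope => [[vL [/andP[aL' Lb] yba]]|[/andP[av vL] vb yav vy]].
    have : 0 <= (ya - yb) * xb by apply: mulr_ge0; lra.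
    have : 0 < (xb - xa) * yb by apply: mulr_gt0; lra.
    lra.
  rewrite yav in m *; have [a0|a0] := leP xa 0.
    have : 0 <= (yb - yv) * - xa by apply: mulr_ge0; lra.
    have : 0 < (xb - xa) * yv by apply: mulr_gt0; lra.
    lra.
  have : 0 <= (xb - xa - (yb - yv)) * xa by apply: mulr_ge0; lra.
  have : 0 < (xb - xa) * (yv - xa) by apply: mulr_gt0; lra.
  lra.
- case: slope => [[vL [/andP[aL' Lb] yba]]|[/andP[av vL] vb yav vy]].
    have : 0 < (xb - L) * ya by apply: mulr_gt0; lra.
    have : 0 <= (L - xa) * yb by apply: mulr_ge0; lra.
    lra.
  have : 0 <= (yb - ya) * (L - xa) by apply: mulr_ge0; lra.
  have : 0 < (xb - xa) * ya by apply: mulr_gt0; lra.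
  lra.
Qed.

Lemma strip_dichotomy X Y K (l r : T) :
  (forall x, x \in K -> 0 < Y x) -> 0 < L ->
  l \in K -> X l + Y l < 0 -> r \in K -> L + Y r < X r ->
  visible_edge X Y K \/ edge_behind_vertex X Y K.
Proof.
move=> Y0 L0 lK lb rK rb.
have [v [vK _ vmin]] := exists_argmin (P := fun=> True) Y lK I.
have {}vmin x : x \in K -> Y v <= Y x by move=> xK; apply: vmin.
have [vC|vC] := pselect (L < X v \/ 0 <= X v <= L /\ X v < Y v).
  by left; apply: (strip_dichotomy_half Y0 vK vmin lK lb rK rb).
(* The same test after the mirror, under which [l] and [r] exchange roles. *)
have [vC'|vC'] := pselect (L < L - X v \/ 0 <= L - X v <= L /\ L - X v < Y v).
  left; apply/visible_edge_mirror/(strip_dichotomy_half Y0 vK vmin rK _ lK _ L0 vC'); lra.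
have v0 : 0 <= X v by rewrite leNgt; apply/negP => ?; apply: vC'; left; lra.
have vL : X v <= L by rewrite leNgt; apply/negP => ?; apply: vC; left.
have vx : Y v <= X v.
  by rewrite leNgt; apply/negP => ?; apply: vC; right; split=> //; lra.
have vx' : Y v <= L - X v.
  by rewrite leNgt; apply/negP => ?; apply: vC'; right; split=> //; lra.
have Yl := Y0 l lK; have Yr := Y0 r rK; have Yv := Y0 v vK.
(* [v] lies over the strip, unlike [l] and [r]; so both stay in [K'] and bound the slope there
   too. *)
pose K' := [seq x <- K | x != v].
have lK' : l \in K' by rewrite mem_filter lK andbT; apply/eqP => lv; rewrite lv in lb; lra.
have rK' : r \in K' by rewrite mem_filter rK andbT; apply/eqP => rv; rewrite rv in rb; lra.
have sub x : x \in K' -> x \in K by rewrite mem_filter => /andP[].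
have lvr : X l <= X v < X r by lra.
have [a [b [aK bK avb le]]] := exists_lower_edge Y lK' rK' lvr.
have ab : X a < X b by lra.
have lab : lower_edge X Y K' a b by split.
have Y0' x : x \in K' -> 0 < Y x by move=> /sub; apply: Y0.
have m : moderate X Y a b.
  by apply: (moderate_lower_edge Y0' aK bK lab _ _ lK' lb rK' rb); lra.
have va := vmin _ (sub _ aK); have vb := vmin _ (sub _ bK).
right; exists v, a, b; split=> //; try exact: sub.
move: (aK) (bK); rewrite !mem_filter => /andP[av _] /andP[bv _].
split=> //; split=> //; first by rewrite v0.
  lra.
split=> //; rewrite /height.
have : 0 <= (X v - X a) * (Y b - Y v) by apply: mulr_ge0; lra.
have : 0 <= (X b - X v) * (Y a - Y v) by apply: mulr_ge0; lra.
lra.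
Qed.
End Strip.

(** * Gentle paths *)

Section Paths.
Variable R : realType.
Implicit Types (p q r a b h u v w x y z : R * R) (s t : seq (R * R)) (S : {fset R * R}).

(* Since [|cross|] and [dot] are the sine and the cosine up to a common factor,
   this says that the convex angle at [q] is at most 3 pi / 4. *)
Definition gentle p q r : Prop :=
  0 <= dot (p - q) (r - q) + `|cross (p - q) (r - q)|.

Definition gentle_at_head p s : Prop := if s is h :: r :: _ then gentle p h r else True.

(* A line through the head [h] separates [p] from the other points of [s], so
   the segment from [p] to [h] meets their convex hull at most in [h]. *)
Definition separated_from p s : Prop :=
  if s is h :: t then
    exists2 w, cross w (p - h) <= 0 &
      forall x, x \in t -> 0 <= cross w (x - h) /\ cross w (p - h) < cross w (x - h)
  else True.

Fixpoint gentle_path s : Prop :=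
  if s is p :: t then [/\ separated_from p t, gentle_at_head p t & gentle_path t]
  else True.

Definition spans S s : Prop := [/\ uniq s, s =i S & gentle_path s].

Definition no_three_collinear S : Prop :=
  forall p q r, p \in S -> q \in S -> r \in S ->
    p != q -> q != r -> p != r -> area p q r != 0.

(** [q] is extreme: the functional [cross w] has its only minimum on [S] there. *)
Definition vertex_paths S : Prop := forall q w, q \in S ->
  (forall x, x \in S -> x != q -> 0 < cross w (x - q)) ->
  exists s, spans S (q :: s).

Definition edge_paths S : Prop := forall q1 q2, q1 \in S -> q2 \in S -> q1 != q2 ->
  (forall x, x \in S -> x != q1 -> x != q2 -> 0 < area q1 q2 x) ->
  exists s, spans S [:: q1, q2 & s] \/ spans S [:: q2, q1 & s].

Lemma gentleC p q r : gentle p q r -> gentle r q p.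
Proof.
rewrite /gentle; have -> : dot (r - q) (p - q) = dot (p - q) (r - q).
  by rewrite /dot /=; ring.
suff -> : cross (r - q) (p - q) = - cross (p - q) (r - q) by rewrite normrN.
by rewrite /cross /=; ring.
Qed.

Lemma dotxx_gt0 u : u != 0 -> 0 < dot u u.
Proof.
move=> u0; rewrite lt_neqAle addr_ge0 ?sqr_ge0 // andbT eq_sym.
apply: contraNneq u0 => /eqP; rewrite paddr_eq0 -?expr2 ?sqr_ge0 //.
by rewrite !sqrf_eq0 -pair_eqE.
Qed.

Lemma gentle_dot p q r : 0 <= dot (p - q) (r - q) -> gentle p q r.
Proof. by move=> H; rewrite /gentle addr_ge0. Qed.

(** The separating line is required for all points of [S], since the induction hypothesis leaves the
    order of [s] open. *)
Lemma spans_cons S q h s w :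
  q \in S -> spans (S `\ q)%fset (h :: s) ->
  cross w (q - h) <= 0 ->
  (forall x, x \in S -> x != q -> x != h ->
    0 <= cross w (x - h) /\ cross w (q - h) < cross w (x - h)) ->
  gentle_at_head q (h :: s) -> spans S [:: q, h & s].
Proof.
move=> qS [us sS gs] wq wS gq.
have qs : q \notin h :: s by rewrite sS !inE eqxx.
split; first by rewrite cons_uniq qs.
- move=> x; rewrite inE sS !inE.
  by case: (eqVneq x q) => // ->; rewrite qS.
- split=> //; exists w => // x xs.
  have : x \in h :: s by rewrite inE xs orbT.
  rewrite sS !inE => /andP[xq xS]; apply: wS => //.
  by apply: contraTneq xs => ->; case/andP: us.
Qed.

Lemma no_three_collinear_sub S S' :
  {subset S' <= S} -> no_three_collinear S -> no_three_collinear S'.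
Proof. by move=> sub gp p q r pS qS rS; apply: gp; apply: sub. Qed.

(** * Coordinates along a hull edge *)

Section Frame.
Variables q1 q2 : R * R.

(** [frameX] and [frameY] are left unnormalised: they form a similarity that multiplies [dot] and
    [cross] by [L], which keeps angles and avoids square roots. *)
Definition frameX x : R := dot (q2 - q1) (x - q1).
Definition frameY x : R := area q1 q2 x.
Let L : R := dot (q2 - q1) (q2 - q1).

Lemma height_frame a b x :
  height frameX frameY a b (frameX x) (frameY x) = L * area a b x.
Proof. by rewrite /height /frameX /frameY /L !areaE /dot /=; ring. Qed.

Lemma dot_frame p q r : L * dot (p - q) (r - q) =
  (frameX p - frameX q) * (frameX r - frameX q) +
  (frameY p - frameY q) * (frameY r - frameY q).
Proof. by rewrite /frameX /frameY /L !areaE /dot /=; ring. Qed.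

Lemma cross_frame p q r : L * cross (p - q) (r - q) =
  (frameX p - frameX q) * (frameY r - frameY q) -
  (frameY p - frameY q) * (frameX r - frameX q).
Proof. by rewrite /frameX /frameY /L !areaE /dot /cross /=; ring. Qed.

(* If the ray [qr] is at most 45 degrees off the horizontal and [p] lies on the
   same side of the vertical through [q] as [r], the angle is at most 90 + 45
   degrees. *)
Lemma gentle_frame p q r : q1 != q2 ->
  0 <= (frameX p - frameX q) * (frameX r - frameX q) ->
  `|frameY r - frameY q| <= `|frameX r - frameX q| ->
  gentle p q r.
Proof.
move=> q12 xx yx; have L0 : 0 < L by rewrite dotxx_gt0 // subr_eq0 eq_sym.
have LE (c : R) : L * `|c| = `|L * c| by rewrite normrM (gtr0_norm L0).
suff : 0 <= L * (dot (p - q) (r - q) + `|cross (p - q) (r - q)|) by rewrite pmulr_rge0.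
rewrite mulrDr LE dot_frame cross_frame; move: xx yx => {LE L0}.
move: (frameX p - frameX q) (frameX r - frameX q) => x1 x2.
move: (frameY p - frameY q) (frameY r - frameY q) => y1 y2 xx yx.
(* By the triangle inequality, the expanded product is a lower bound of the goal. *)
have : 0 <= (`|x1| + `|y1|) * (`|x2| - `|y2|) by rewrite mulr_ge0 ?subr_ge0 ?addr_ge0.
have xxE : `|x1| * `|x2| = x1 * x2 by rewrite -normrM ger0_norm.
have := ler_norm (- (y1 * y2)); rewrite normrN normrM => h1.
have := lerB_dist (y1 * x2) (x1 * y2); rewrite distrC !normrM => h2 h3.
rewrite mulrBr !mulrDl xxE in h3; lra.
Qed.

Lemma frame_origin : (frameX q1 = 0) * (frameY q1 = 0).
Proof. by rewrite /frameX /frameY areaE /dot /=; split; ring. Qed.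

Lemma frame_end : (frameX q2 = L) * (frameY q2 = 0).
Proof. by rewrite /frameX /frameY areaE /dot /=; split; [|ring]. Qed.

End Frame.

(** * The induction step *)

Section Step.
Variable S : {fset R * R}.
Hypothesis gpS : no_three_collinear S.
Hypothesis IHS : forall S', (#|` S'| < #|` S|)%N ->
  {subset S' <= S} -> vertex_paths S' /\ edge_paths S'.

Lemma IHD1 q : q \in S -> vertex_paths (S `\ q)%fset /\ edge_paths (S `\ q)%fset.
Proof.
move=> qS; apply: IHS => [|x]; last by rewrite !inE => /andP[].
by rewrite [ltnRHS](cardfsD1 q) qS.
Qed.

Lemma IHD2 q r : q \in S -> r \in S -> q != r ->
  vertex_paths (S `\ q `\ r)%fset /\ edge_paths (S `\ q `\ r)%fset.
Proof.
move=> qS rS qr; apply: IHS => [|x]; last by rewrite !inE => /andP[_ /andP[]].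
rewrite [ltnRHS](cardfsD1 q) qS (cardfsD1 r (S `\ q)%fset) !inE eq_sym qr rS.
by rewrite !addSn !add0n ltnS leqnSn.
Qed.

Lemma IHD3 q r v : q \in S -> r \in S -> v \in S -> q != r -> v != q -> v != r ->
  edge_paths (S `\ q `\ r `\ v)%fset.
Proof.
move=> qS rS vS qr vq vr.
apply: (IHS _ _).2 => [|x]; last by rewrite !inE => /andP[_ /andP[_ /andP[]]].
rewrite [ltnRHS](cardfsD1 q) qS (cardfsD1 r (S `\ q)%fset) !inE eq_sym qr rS.
rewrite (cardfsD1 v (S `\ q `\ r)%fset) !inE vr vq vS.
by rewrite !addSn !add0n ltnS ltnW.
Qed.

(** The path from (V) for [h] leaves the vertex after [h] open, so the angle at [h] is bounded for
    every candidate. *)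
Lemma gentle_vertex_path q h w :
  q \in S -> h \in S -> q != h ->
  cross w (q - h) <= 0 ->
  (forall x, x \in S -> x != q -> x != h -> 0 < cross w (x - h)) ->
  (forall x, x \in S -> x != q -> x != h -> gentle q h x) ->
  exists s, spans S [:: q, h & s].
Proof.
move=> qS hS qh wq wS gS.
have [|x|s sp] := (IHD1 qS).1 h w; first by rewrite !inE eq_sym qh.
  by rewrite !inE => /andP[xq xS] xh; apply: wS.
exists s; apply: (spans_cons (w := w)) => //.
  move=> x xS xq xh; have wx := wS x xS xq xh; split; first exact: ltW.
  exact: le_lt_trans wx.
case: sp => us sS _; case: s us sS => [//|r s] us sS.
have : r \in [:: h, r & s] by rewrite !inE eqxx orbT.
rewrite sS !inE => /andP[rq rS]; apply: gS => //.
by move: us => /=; rewrite !inE negb_or eq_sym => /andP[/andP[]].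
Qed.

(* [yz] is an edge of the convex hull of [S \ q] and its line separates [q]
   from the other points. *)
Definition visible_from q y z : Prop :=
  [/\ y \in S, z \in S, y != q, z != q & y != z /\
    forall x, x \in S -> x != q -> x != y -> x != z -> area y z x * area y z q < 0].

Lemma visible_fromC q y z : visible_from q y z -> visible_from q z y.
Proof.
move=> [yS zS yq zq [yz H]]; split=> //; split; first by rewrite eq_sym.
move=> x xS xq xz xy; have := H x xS xq xy xz.
by rewrite (areaC z) (areaC z) mulrNN.
Qed.

Lemma spans_visible q y z s :
  q \in S -> visible_from q y z -> spans (S `\ q)%fset [:: y, z & s] ->
  gentle q y z -> spans S [:: q, y, z & s].
Proof.
move=> qS [yS zS yq zq [yz vis]] sp g.
have A0 : area y z q != 0 by apply: gpS.
(* The factor [- area y z q] orients the line [yz] so that [q] is on its negative side. *)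
apply: (spans_cons (w := - area y z q *: (z - y))) => //.
  by rewrite crossZ mulNr oppr_le0 -expr2 sqr_ge0.
have cE x : cross (- area y z q *: (z - y)) (x - y) = - (area y z x * area y z q).
  by rewrite crossZ mulNr mulrC.
move=> x xS xq xy; rewrite !cE.
have : 0 < area y z q * area y z q by rewrite -expr2 exprn_even_gt0.
have [->|xz] := eqVneq x z.
  rewrite area_id.
  by rewrite mul0r oppr0; lra.
by have := vis x xS xq xy xz; lra.
Qed.

(** Both angles are bounded because (E) may give a path starting with [y, z] or with [z, y]. *)
Lemma gentle_visible_edge q y z :
  q \in S -> visible_from q y z -> gentle q y z -> gentle q z y ->
  exists s, spans S (q :: s).
Proof.
move=> qS vis gy gz; have visC := visible_fromC vis.
have [yS zS yq zq [yz vS]] := vis; have [_ _ _ _ [zy vSC]] := visC.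
have yK : y \in (S `\ q)%fset by rewrite !inE yq.
have zK : z \in (S `\ q)%fset by rewrite !inE zq.
have A0 : area y z q != 0 by apply: gpS.
have [s sp] : exists s, spans (S `\ q)%fset [:: y, z & s] \/
    spans (S `\ q)%fset [:: z, y & s].
  have [A|A] := ltP (area y z q) 0.
    apply: (IHD1 qS).2 => // x; rewrite !inE => /andP[xq xS] xy xz.
    by have := vS x xS xq xy xz; rewrite nmulr_llt0.
  have {}A : 0 < area y z q by rewrite lt_neqAle eq_sym A0.
  have [|s sp] := (IHD1 qS).2 z y zK yK zy; last by exists s; case: sp; [right|left].
  move=> x; rewrite !inE => /andP[xq xS] xz xy.
  have := vS x xS xq xy xz; rewrite pmulr_llt0 // !areaE; lra.
by case: sp => sp; eexists; apply: spans_visible sp _.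
Qed.

(** The path is [q, z] followed by one from (V) for [y]; the line [yz] separates both prepended
    points. *)
Lemma gentle_visible_vertex q y z :
  q \in S -> visible_from q y z -> gentle q z y ->
  (forall x, x \in S -> x != q -> x != y -> x != z -> gentle z y x) ->
  exists s, spans S (q :: s).
Proof.
move=> qS vis gz gy; have visC := visible_fromC vis.
have [yS zS yq zq [yz vS]] := vis; have [_ _ _ _ [zy vSC]] := visC.
have A0 : area y z q != 0 by apply: gpS.
have cE x : cross (- area y z q *: (z - y)) (x - y) = - (area y z x * area y z q).
  by rewrite crossZ mulNr mulrC.
have qz : q != z by rewrite eq_sym.
have [|x|s sp] := (IHD2 qS zS qz).1 y (- area y z q *: (z - y)).
- by rewrite !inE yz yq yS.
- rewrite !inE => /and3P[xz xq xS] xy; rewrite cE oppr_gt0; exact: vS.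
exists [:: z, y & s]; apply: spans_visible => //.
apply: (spans_cons (w := - area y z q *: (z - y))) => //.
- by rewrite !inE zq.
- rewrite cE; rewrite area_id.
  by rewrite mul0r oppr0.
- move=> x; rewrite !inE => /andP[xq xS] xz xy; rewrite !cE.
  rewrite area_id.
  by have := vS x xS xq xy xz; rewrite mul0r; lra.
case: sp => us sS _; case: s us sS => [//|x s] us sS.
have : x \in [:: y, x & s] by rewrite !inE eqxx orbT.
rewrite sS !inE => /and3P[xz xq xS]; apply: gy => //.
by move: us => /=; rewrite !inE negb_or eq_sym => /andP[/andP[]].
Qed.
(** [y] comes first in counterclockwise order around [q], and [z] last around [y]. Sets of one or
    two points have a path at once. *)
Lemma exists_visible q w : q \in S ->
  (forall x, x \in S -> x != q -> 0 < cross w (x - q)) ->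
  (exists s, spans S (q :: s)) \/ exists y z, visible_from q y z.
Proof.
move=> qS wS.
have [[x0 [x0S x0q]]|nox] := pselect (exists x, x \in S /\ x != q); last first.
  left; exists [::]; split=> // x; rewrite inE.
  have [->|xq] := eqVneq x q; first by rewrite qS.
  by apply/esym/negbTE/negP => xS; apply: nox; exists x.
have x0T : x0 \in (S `\ q)%fset by rewrite !inE x0q.
have wT x : x \in (S `\ q)%fset -> 0 < cross w (x - q).
  by rewrite !inE => /andP[xq xS]; apply: wS.
have [y yT ymin] := exists_angular_extreme (-1) x0T wT.
have /andP[yq yS] : (y != q) && (y \in S) by move: yT; rewrite !inE.
have qy : q != y by rewrite eq_sym.
have [[x1 [x1S x1q x1y]]|nox] := pselect (exists x, [/\ x \in S, x != q & x != y]); last first.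
  left; have none x : x \in S -> x != q -> x != y -> False.
    by move=> xS xq xy; apply: nox; exists x.
  have [|||s sp] := gentle_vertex_path (w := 0) qS yS qy; last by exists (y :: s).
  - by rewrite /cross !mul0r subrr.
  - by move=> x xS xq /(none x xS xq).
  - by move=> x xS xq /(none x xS xq).
right; have x1T : x1 \in (S `\ q `\ y)%fset by rewrite !inE x1y x1q.
have area_qy x : x \in S -> x != q -> x != y -> 0 < area q y x.
  move=> xS xq xy; rewrite lt_neqAle eq_sym gpS //=; last 2 first.
  - by rewrite eq_sym.
  - by rewrite eq_sym.
  have := ymin x; rewrite !inE xq xS => /(_ isT); rewrite areaE [area q y x]areaE; lra.
have wT' x : x \in (S `\ q `\ y)%fset -> 0 < cross (y - q) (x - y).
  rewrite !inE => /and3P[xy xq xS]; have := area_qy x xS xq xy.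
  by rewrite areaE /cross /=; lra.
have [z zT zmin] := exists_angular_extreme 1 x1T wT'.
have /and3P[zy zq zS] : [&& z != y, z != q & z \in S] by move: zT; rewrite !inE.
exists y, z; split=> //; split; first by rewrite eq_sym.
move=> x xS xq xy xz; rewrite nmulr_rlt0.
  by have := area_qy z zS zq zy; rewrite !areaE; lra.
have : area y z x != 0 by apply: gpS => //; rewrite eq_sym.
have := zmin x; rewrite !inE xy xq xS => /(_ isT); rewrite mul1r => h n0.
rewrite lt_neqAle n0; move: h; rewrite !areaE; lra.
Qed.

(** In the triangle [qyp] the side [qy] is at most as long as [qp], so the angle opposite to it, at
    [p], is acute. *)
Lemma exists_nearest_visible q w : q \in S ->
  (forall x, x \in S -> x != q -> 0 < cross w (x - q)) ->
  (exists s, spans S (q :: s)) \/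
  exists y z, [/\ visible_from q y z, gentle q z y &
    forall p, visible_from q y p -> gentle q p y].
Proof.
move=> qS wS; have [|[y0 [z0 vis0]]] := exists_visible qS wS; first by left.
right; have [y0S z0S _ _ _] := vis0.
have [[y z] [_ /= vis ymin]] :=
  exists_argmin (P := fun yz => visible_from q yz.1 yz.2)
    (fun yz => dot (yz.1 - q) (yz.1 - q)) (allpairs_f pair y0S z0S) vis0.
have near p : visible_from q y p -> gentle q p y.
  move=> visp; have [yS pS _ _ _] := visp.
  have := ymin (p, y) (allpairs_f pair pS yS) (visible_fromC visp).
  have := sqr_ge0 (y.1 - p.1); have := sqr_ge0 (y.2 - p.2).
  move=> h1 h2 /= h3; apply: gentle_dot; move: h3; rewrite /dot /=; lra.
by exists y, z; split=> //; apply: near.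
Qed.

Lemma vertex_step : vertex_paths S.
Proof.
move=> q w qS wS.
have [//|[y [z [vis gz near]]]] := exists_nearest_visible qS wS.
have [yS zS yq zq [yz vS]] := vis.
have [gy|ngy] := pselect (gentle q y z); first exact: gentle_visible_edge vis gy gz.
have [[x1 [x1S x1q x1y x1z]]|nox] :=
  pselect (exists x, [/\ x \in S, x != q, x != y & x != z]); last first.
  apply: gentle_visible_vertex vis gz _ => // x xS xq xy xz.
  by case: nox; exists x.
pose A := area y z q.
have cE x : cross (- A *: (z - y)) (x - y) = - (area y z x * A).
  by rewrite crossZ mulNr mulrC.
have x1T : x1 \in (S `\ q `\ y `\ z)%fset by rewrite !inE x1y x1q x1z.
have wT x : x \in (S `\ q `\ y `\ z)%fset -> 0 < cross (- A *: (z - y)) (x - y).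
  by rewrite !inE => /and4P[xz xy xq xS]; rewrite cE oppr_gt0; apply: vS.
(* [p] is the hull neighbour of [y] other than [z]; the factor [- A] covers both orientations. *)
have [p pT pmax] := exists_angular_extreme (- A) x1T wT.
have /and4P[pz py pq pS] : [&& p != z, p != y, p != q & p \in S].
  by move: pT; rewrite !inE.
have Ap : area y z p * A < 0 by apply: vS.
have Aq0 : area y p q != 0 by apply: gpS => //; rewrite eq_sym.
have A0 : A != 0 by apply: gpS.
have A2 : 0 < A * A by rewrite -expr2 exprn_even_gt0.
have pext x : x \in S -> x != q -> x != y -> x != p -> 0 < area y p x * A.
  move=> xS xq xy xp; have [->|xz] := eqVneq x z.
    by move: Ap; rewrite !areaE; lra.
  rewrite lt_neqAle eq_sym mulf_neq0 //=; last by apply: gpS => //; rewrite eq_sym.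
  have := pmax x; rewrite !inE xz xy xq xS => /(_ isT).
  by rewrite !areaE; lra.
have [[visp gp]|nvis] := pselect (visible_from q y p /\ gentle q y p).
  exact: gentle_visible_edge visp gp (near p visp).
have uy : q - y != 0 by rewrite subr_eq0 eq_sym.
have u0 := dotxx_gt0 uy.
have AE : A = cross (z - y) (q - y) by [].
have zp0 : 0 <= dot (z - y) (p - y).
  (* The cosine of a difference, with angles measured from [q - y]. *)
  rewrite -(pmulr_rge0 _ u0).
  have -> : dot (q - y) (q - y) * dot (z - y) (p - y) =
     dot (q - y) (z - y) * dot (q - y) (p - y) +
     cross (q - y) (z - y) * cross (q - y) (p - y).
    by rewrite /dot /cross /=; ring.
  have dz : dot (q - y) (z - y) + `|cross (q - y) (z - y)| < 0.
    by rewrite ltNge; apply/negP.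
  (* If [yp] is visible, the angles [qyz] and [qyp] both exceed 3 pi / 4, which leaves less than pi
     / 2 for [zyp]. *)
  have [Bq|Bq] := ltP (area y p q * A) 0.
    have visp : visible_from q y p.
      split=> //; split=> [|x xS xq xy xp]; first by rewrite eq_sym.
      have := pext x xS xq xy xp => Bx.
      rewrite -(nmulr_rgt0 _ (_ : - (A * A) < 0)) ?oppr_lt0 //.
      have := mulr_gt0 Bx (_ : 0 < - (area y p q * A)); rewrite oppr_gt0 => /(_ Bq).
      by lra.
    have dp : dot (q - y) (p - y) + `|cross (q - y) (p - y)| < 0.
      by rewrite ltNge; apply/negP => gp; apply: nvis.
    move: dz dp; rewrite -[X in 0 <= _ + X]mulrNN.
    move: (dot (q - y) (z - y)) (dot (q - y) (p - y)) => d1 d2.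
    move: (cross (q - y) (z - y)) (cross (q - y) (p - y)) => c1 c2 h1 h2.
    have : `|c1| * `|c2| <= (- d1) * (- d2) by apply: ler_pM => //; lra.
    rewrite -normrM; have := ler_norm (- (c1 * c2)); rewrite normrN; lra.
  (* Otherwise the ray [yz] lies inside the angle [qyp]; so [qyz] and [qyp] are both obtuse, and
     both terms of the formula are nonnegative. *)
  have {}Bq : 0 < area y p q * A by rewrite lt_neqAle eq_sym mulf_neq0.
  have dz0 : dot (q - y) (z - y) < 0.
    by have := normr_ge0 (cross (q - y) (z - y)); lra.
  have id2 : dot (q - y) (q - y) * (A * area y z p) =
      dot (q - y) (z - y) * - (area y p q * A) + A * A * dot (q - y) (p - y).
    by rewrite AE !areaE /dot /cross /=; ring.
  have dp0 : dot (q - y) (p - y) < 0.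
    rewrite -(pmulr_rlt0 _ A2).
    have : dot (q - y) (q - y) * (A * area y z p) < 0 by rewrite pmulr_rlt0 // mulrC.
    have : 0 < dot (q - y) (z - y) * - (area y p q * A).
      by rewrite nmulr_rgt0 // oppr_lt0.
    by rewrite id2; lra.
  have -> : cross (q - y) (z - y) * cross (q - y) (p - y) = area y p q * A.
    by rewrite AE !areaE /cross /=; ring.
  by rewrite addr_ge0 ?(ltW Bq) // mulr_le0 // ltW.
apply: gentle_visible_vertex vis gz _ => // x xS xq xy xz.
apply: gentle_dot.
have zpA : 0 < - (area y z p * A) by rewrite oppr_gt0.
have zxA : 0 < - (area y z x * A) by rewrite oppr_gt0; apply: vS.
have pxA : 0 <= area y p x * A.
  by have [->|xp] := eqVneq x p; [rewrite area_id mul0r|exact/ltW/pext].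
(* [x - y] is a nonnegative combination of [z - y] and [p - y], and both have a nonnegative product
   with [z - y]. *)
rewrite -(pmulr_rge0 _ zpA).
have -> : - (area y z p * A) * dot (z - y) (x - y) =
    dot (z - y) (z - y) * (area y p x * A) + dot (z - y) (p - y) * - (area y z x * A).
  by rewrite !areaE /dot /cross /=; ring.
by rewrite addr_ge0 // mulr_ge0 // ?(ltW zxA) // addr_ge0 // -expr2 sqr_ge0.
Qed.

Lemma spans_edge_cons q1 q2 h s w :
  q1 \in S -> q2 \in S -> q1 != q2 ->
  (forall x, x \in S -> x != q1 -> x != q2 -> 0 < cross w (x - q2)) ->
  cross w (q1 - q2) = 0 ->
  spans (S `\ q1)%fset [:: q2, h & s] -> gentle q1 q2 h ->
  spans S [:: q1, q2, h & s].
Proof.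
move=> q1S q2S q12 up w0 sp g; apply: (spans_cons (w := w)) => //; rewrite w0 //.
by move=> x xS x1 x2; have := up x xS x1 x2; split=> //; apply: ltW.
Qed.

Lemma edge_step : edge_paths S.
Proof.
move=> q1 q2 q1S q2S q12 up; have q21 : q2 != q1 by rewrite eq_sym.
pose w := q2 - q1.
have w1 x : cross w (x - q1) = area q1 q2 x by [].
have w2 x : cross w (x - q2) = area q1 q2 x.
  by rewrite areaE /cross /=; ring.
have up1 x : x \in S -> x != q2 -> x != q1 -> 0 < cross w (x - q1).
  by move=> xS x2 x1; rewrite w1; apply: up.
have up2 x : x \in S -> x != q1 -> x != q2 -> 0 < cross w (x - q2).
  by move=> xS x1 x2; rewrite w2; apply: up.
have w12 : cross w (q1 - q2) = 0 by rewrite w2 areaE; ring.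
have w21 : cross w (q2 - q1) = 0 by rewrite /cross mulrC subrr.
have [g|ng] := pselect (forall x, x \in S -> x != q1 -> x != q2 -> gentle q1 q2 x).
  have [|s sp] := gentle_vertex_path q1S q2S q12 _ up2 g; first by rewrite w12.
  by exists s; left.
have [g'|ng'] := pselect (forall x, x \in S -> x != q2 -> x != q1 -> gentle q2 q1 x).
  have [|s sp] := gentle_vertex_path q2S q1S q21 _ up1 g'; first by rewrite w21.
  by exists s; right.
pose X := frameX q1 q2; pose Y := frameY q1 q2; pose L := dot (q2 - q1) (q2 - q1).
have L0 : 0 < L by apply: dotxx_gt0; rewrite subr_eq0.
pose K := (S `\ q1 `\ q2)%fset.
have inK x : x \in K -> [/\ x \in S, x != q1 & x != q2].
  by rewrite !inE => /and3P[].
have Y0 x : x \in K -> 0 < Y x by move=> /inK[]; apply: up.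
(* A wide angle at [q2] puts the point below the diagonal [Y = X - L], one at [q1] below
   [Y = - X]. *)
have [r rK rb] : exists2 r, r \in K & L + Y r < X r.
  apply: contra_notP ng => nr x xS x1 x2; apply: contra_notP nr => ngx.
  have xK : x \in K by rewrite !inE x1 x2.
  exists x => //; move/negP: ngx; rewrite -ltNge.
  have -> : cross (q1 - q2) (x - q2) = - Y x by rewrite /Y /frameY areaE /cross /=; ring.
  have -> : dot (q1 - q2) (x - q2) = L - X x by rewrite /X /frameX /L /dot /=; ring.
  by rewrite normrN gtr0_norm ?Y0 //; lra.
have [l lK lb] : exists2 l, l \in K & X l + Y l < 0.
  apply: contra_notP ng' => nr x xS x2 x1; apply: contra_notP nr => ngx.
  have xK : x \in K by rewrite !inE x1 x2.
  exists x => //; move/negP: ngx; rewrite -ltNge.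
  by rewrite -[cross _ _]/(Y x) gtr0_norm ?Y0.
have X1 : X q1 = 0 by rewrite /X frame_origin.
have Y1 : Y q1 = 0 by rewrite /Y frame_origin.
have X2 : X q2 = L by rewrite /X frame_end.
have Y2 : Y q2 = 0 by rewrite /Y frame_end.
have hE a b x : height X Y a b (X x) (Y x) = L * area a b x by exact: height_frame.
have gE p q u : 0 <= (X p - X q) * (X u - X q) ->
  `|Y u - Y q| <= `|X u - X q| -> gentle p q u by exact: gentle_frame.
have ca a b x : cross (b - a) (x - a) = area a b x by [].
have cb a b x : cross (b - a) (x - b) = area a b x by rewrite areaE /cross /=; ring.
have g12 x : X x <= L -> gentle q1 q2 x.
  move=> xL; apply/gentleC/gE; last by rewrite Y1 Y2 subrr normr0.
  by rewrite X1 X2 sub0r mulr_le0 ?subr_le0 // oppr_le0 ltW.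
have g21 x : 0 <= X x -> gentle q2 q1 x.
  move=> x0; apply/gentleC/gE; last by rewrite Y1 Y2 subrr normr0.
  by rewrite X1 X2 !subr0 mulr_ge0 // ltW.
have slope a b : X a < X b -> moderate X Y a b ->
    `|Y b - Y a| <= `|X b - X a| /\ `|Y a - Y b| <= `|X a - X b|.
  move=> ab /andP[m1 m2]; rewrite (distrC (Y a)) (distrC (X a)).
  have -> : `|X b - X a| = X b - X a by rewrite gtr0_norm // subr_gt0.
  by split; rewrite ler_norml !ltW.
have KC : (S `\ q2 `\ q1)%fset = (S `\ q1 `\ q2)%fset.
  by apply/fsetP => x; rewrite !inE; case: (x == q1); case: (x == q2).
(* General position makes the inequalities of a lower edge strict, as (E) demands. [K'] will be [K]
   with or without [v]. *)
have strict a b (K' : seq (R * R)) : {subset K' <= K} -> a \in K' -> b \in K' -> a != b ->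
    (forall x, x \in K' -> 0 <= height X Y a b (X x) (Y x)) ->
    forall x, x \in K' -> x != a -> x != b -> 0 < area a b x.
  move=> sub aK bK ab le x xK xa xb.
  have [aS _ _] := inK a (sub a aK); have [bS _ _] := inK b (sub b bK).
  have [xS _ _] := inK x (sub x xK).
  have : area a b x != 0 by apply: gpS => //; rewrite eq_sym.
  by rewrite lt_neqAle eq_sym => ->; rewrite -(pmulr_rge0 _ L0) -hE le.
have weak a b (K' : seq (R * R)) :
    (forall x, x \in K' -> 0 <= height X Y a b (X x) (Y x)) ->
    forall x, x \in K' -> 0 <= area a b x.
  by move=> le x xK; rewrite -(pmulr_rge0 _ L0) -hE le.
have [[a [b [aK bK [ab le] m [aL b0]]]]|] := strip_dichotomy Y0 L0 lK lb rK rb.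
  have -> : height X Y a b 0 0 = L * area a b q1 by rewrite -hE X1 Y1.
  have -> : height X Y a b L 0 = L * area a b q2 by rewrite -hE X2 Y2.
  rewrite !pmulr_rlt0 // => h1 h2.
  have [aS a1 a2] := inK a aK; have [bS b1 b2] := inK b bK.
  have anb : a != b by apply: contraTneq ab => ->; rewrite ltxx.
  have [sab sba] := slope a b ab m.
  have wk := weak a b K le.
  have [|s sp] := (IHD2 q1S q2S q12).2 a b aK bK anb.
    by move=> x xK xa xb; apply: (strict a b K).
  (* [X a <= L] bounds the angle at [q2] and, with the slope, that at [a]; in the other order
     [0 <= X b] does so at [q1] and [b]. *)
  case: sp => sp.
    exists [:: a, b & s]; left; apply: (spans_edge_cons (w := w)) => //; last exact: g12.
    apply: (spans_cons (w := b - a)) sp _ _ _ => //; first by rewrite !inE q21.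
    - by rewrite ca ltW.
    - move=> x; rewrite !inE !ca => /andP[x1 xS] x2 _.
      have xK : x \in K by rewrite !inE x1 x2.
      by have := wk x xK; split=> //; apply: lt_le_trans h2 _.
    - by apply: gE sab; rewrite X2 mulr_ge0 ?subr_ge0 // ltW.
  exists [:: b, a & s]; right; apply: (spans_edge_cons (w := w)) => //; last exact: g21.
  rewrite -KC in sp; apply: (spans_cons (w := b - a)) sp _ _ _ => //; first by rewrite !inE q12.
  - by rewrite cb ltW.
  - move=> x; rewrite !inE !cb => /andP[x2 xS] x1 _.
    have xK : x \in K by rewrite !inE x1 x2.
    by have := wk x xK; split=> //; apply: lt_le_trans h1 _.
  - by apply: gE sba; rewrite X1 mulr_le0 ?subr_le0 // ltW.
move=> [v [a [b [vK aK bK [av bv [ab le] m [/andP[v0 vL] vy vy' /andP[avx vbx] [vmin hv]]]]]]].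
have [vS v1 v2] := inK v vK; have [aS a1 a2] := inK a aK; have [bS b1 b2] := inK b bK.
have anb : a != b by apply: contraTneq ab => ->; rewrite ltxx.
have Yv := Y0 v vK; have [sab sba] := slope a b ab m.
have h : area a b v < 0.
  by rewrite lt_neqAle gpS //= -(pmulr_rle0 _ L0) -hE.
have inK' x : x \in [seq x <- K | x != v] -> x \in K by rewrite mem_filter => /andP[].
have KvE x : (x \in (S `\ q1 `\ q2 `\ v)%fset) = (x \in [seq x <- K | x != v]).
  by rewrite mem_filter in_fsetD1.
have wk x : x \in S -> x != q1 -> x != q2 -> x != v -> 0 <= area a b x.
  move=> xS x1 x2 xv; apply: (weak _ _ _ le).
  by rewrite mem_filter xv !inE x1 x2.
have [|||x|s sp] := IHD3 q1S q2S vS q12 v1 v2 (q1 := a) (q2 := b).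
- by rewrite KvE mem_filter av.
- by rewrite KvE mem_filter bv.
- exact: anb.
- rewrite KvE => xK xa xb; apply: (strict _ _ _ inK') => //.
  + by rewrite mem_filter av.
  + by rewrite mem_filter bv.
have cw x y : cross w (x - y) = Y x - Y y.
  by rewrite /w /Y /frameY !areaE /cross /=; clear; ring.
case: sp => sp; [exists [:: v, a, b & s]; right|exists [:: v, b, a & s]; left].
- apply: (spans_edge_cons (w := w)) => //; last exact: g21.
  (* As [v] is lowest, the horizontal line through it separates [q1] from the rest; the line [ab]
     then separates [v]. *)
  apply: (spans_cons (w := w)); first by rewrite !inE q12.
  + rewrite KC; apply: (spans_cons (w := b - a)) sp _ _ _ => //.
    * by rewrite ca ltW.
    * move=> x; rewrite !inE !ca => /and3P[x2 x1 xS] xv _.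
      by have ax := wk x xS x1 x2 xv; split=> //; apply: lt_le_trans h _.
    * by apply: gE sab; rewrite mulr_ge0 ?subr_ge0 // ltW.
  + by rewrite cw Y1 sub0r oppr_le0 ltW.
  + move=> x; rewrite !inE !cw Y1 => /andP[x2 xS] x1 _.
    have xK : x \in K by rewrite !inE x1 x2.
    by rewrite subr_ge0 vmin // ltrD2r Y0.
  (* By [Y v <= X v] the ray from [v] to [q1] is at most 45 degrees off the horizontal, and [a] is
     on the same side of [v] as [q1]. *)
  + apply/gentleC/gE; first by rewrite X1 mulr_le0 ?subr_le0.
    by rewrite X1 Y1 !sub0r !normrN gtr0_norm // ger0_norm.
- apply: (spans_edge_cons (w := w)) => //; last exact: g12.
  apply: (spans_cons (w := w)); first by rewrite !inE q21.
  + apply: (spans_cons (w := b - a)) sp _ _ _ => //.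
    * by rewrite cb ltW.
    * move=> x; rewrite !inE !cb => /and3P[x2 x1 xS] xv _.
      by have ax := wk x xS x1 x2 xv; split=> //; apply: lt_le_trans h _.
    * by apply: gE sba; rewrite mulr_le0 ?subr_le0 // ltW.
  + by rewrite cw Y2 sub0r oppr_le0 ltW.
  + move=> x; rewrite !inE !cw Y2 => /andP[x1 xS] x2 _.
    have xK : x \in K by rewrite !inE x1 x2.
    by rewrite subr_ge0 vmin // ltrD2r Y0.
  + apply/gentleC/gE; first by rewrite X2 mulr_ge0 ?subr_ge0.
    by rewrite X2 Y2 sub0r normrN gtr0_norm // ger0_norm // subr_ge0.
Qed.

End Step.

Lemma paths_exist S : no_three_collinear S -> vertex_paths S /\ edge_paths S.
Proof.
have [n] := ubnP #|` S|; elim: n S => // n IH S Sn gpS.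
have IHS S' : (#|` S'| < #|` S|)%N -> {subset S' <= S} ->
    vertex_paths S' /\ edge_paths S'.
  move=> cS sub; apply: IH; last exact: no_three_collinear_sub gpS.
  exact: leq_trans cS _.
by split; [apply: vertex_step|apply: edge_step].
Qed.

(* A point farthest from the origin is an extreme point. *)
Lemma exists_gentle_spanning_path S :
  S != fset0 -> no_three_collinear S -> exists s, spans S s.
Proof.
move=> /fset0Pn[x0 x0S] gpS.
have [q [qS _ qmax]] := exists_argmin (P := fun=> True) (fun x => - dot x x) x0S I.
(* With [q] turned by a right angle as [w], the functional is [- dot q (x - q)]. *)
have [|s sp] := (paths_exist gpS).1 q (- q.2, q.1) qS; last by exists (q :: s).
move=> x xS xq; have := qmax x xS I; rewrite lerN2.
have : 0 < dot (x - q) (x - q) by apply: dotxx_gt0; rewrite subr_eq0.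
rewrite /dot /cross /=; lra.
Qed.

End Paths.

(** * From gentle paths to open plane graphs *)

Section Infix.
Variable T : eqType.
Implicit Types (a b p q r : T) (s t : seq T).

Lemma infix2_cons a b p q s :
  infix [:: a; b] [:: p, q & s] =
  ((a == p) && (b == q)) || infix [:: a; b] (q :: s).
Proof. by rewrite infix_consl /= prefix0s andbT. Qed.

Lemma infix2_nil a b p : infix [:: a; b] [:: p] = false.
Proof. by apply/negbTE/negP => /size_infix. Qed.

Lemma infix2_next_inj s p q r : uniq s ->
  infix [:: p; q] s -> infix [:: p; r] s -> q = r.
Proof.
elim: s => [|x [|y s] IH]; rewrite ?infix2_nil // cons_uniq => /andP[xs us].
have nx z : infix [:: x; z] (y :: s) -> False.
  by move=> /mem_infix /(_ x); rewrite mem_head (negPf xs) => /(_ isT).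
rewrite !infix2_cons => /orP[/andP[/eqP-> /eqP->]|pq] /orP[/andP[/eqP px /eqP->]|pr] //.
- by case: (nx r).
- by case: (nx q); rewrite -px.
- exact: IH.
Qed.

Lemma infix2_prev_inj s p q r : uniq s ->
  infix [:: q; p] s -> infix [:: r; p] s -> q = r.
Proof.
move=> us; rewrite -[infix _ s]infix_rev -[infix [:: r; p] s]infix_rev.
by apply: infix2_next_inj; rewrite rev_uniq.
Qed.

Lemma infix_map (T' : eqType) (f : T -> T') s t :
  infix s t -> infix (map f s) (map f t).
Proof.
by move=> /infixP[t1 [t2 ->]]; rewrite !map_cat; apply/infixP; eexists; eexists.
Qed.
End Infix.

(** * Planarity and angles of gentle paths *)

Section Drawing.
Variable R : realType.
Implicit Types (p q a b c d h u v w x : R * R) (s : seq (R * R)).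

Lemma segmentC p q x : segment p q x -> segment q p x.
Proof.
move=> [t t01 ->]; exists (1 - t); first lra.
by rewrite subKr addrC.
Qed.

Lemma crossr_combination w h p q (t : R) :
  cross w ((1 - t) *: p + t *: q - h) =
  (1 - t) * cross w (p - h) + t * cross w (q - h).
Proof.
set z := (_ + _ - h : R * R).
have z1 : z.1 = (1 - t) * p.1 + t * q.1 - h.1 by [].
have z2 : z.2 = (1 - t) * p.2 + t * q.2 - h.2 by [].
by rewrite /cross z1 z2 /=; ring.
Qed.

Lemma area_segment a b x : segment a b x -> area a b x = 0.
Proof.
move=> [t _ ->]; rewrite /area crossr_combination subrr.
by rewrite /cross /=; ring.
Qed.

(** The functional of the separating line is nonpositive on [ph] and nonnegative on [cd], so it
    vanishes at [x]. If [x] is not [h], it vanishes at [p] too and is then positive at all of [s],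
    which again leaves only [h] on [cd]. *)
Lemma separated_segment p h s c d x :
  separated_from p (h :: s) -> c \in h :: s -> d \in h :: s -> c != d ->
  segment p h x -> segment c d x -> x = h.
Proof.
move=> [w wp ws] cs ds cd [t /andP[t0 t1] ->] [u /andP[u0 u1] xE].
have [-> | t1'] := eqVneq t 1; first by rewrite subrr scale0r add0r scale1r.
have w0 : cross w (h - h) = 0 by rewrite subrr /cross /=; ring.
have wge y : y \in h :: s -> 0 <= cross w (y - h).
  by rewrite inE => /predU1P[->|/ws[]//]; rewrite w0.
have t1p : 0 < 1 - t by rewrite subr_gt0 lt_neqAle t1'.
have E : (1 - t) * cross w (p - h) = (1 - u) * cross w (c - h) + u * cross w (d - h).
  by rewrite -crossr_combination -xE crossr_combination w0 mulr0 addr0.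
have C0 : 0 <= (1 - u) * cross w (c - h) by rewrite mulr_ge0 ?wge // subr_ge0.
have D0 : 0 <= u * cross w (d - h) by rewrite mulr_ge0 ?wge.
have P0 : (1 - t) * cross w (p - h) <= 0 by rewrite pmulr_rle0.
have /eqP : (1 - t) * cross w (p - h) = 0 by lra.
rewrite mulf_eq0 gt_eqF //= => /eqP wp0.
have wgt y : y \in h :: s -> y != h -> cross w (y - h) != 0.
  by rewrite inE => /predU1P[->|/ws[_]]; rewrite ?eqxx // wp0 => /gt_eqF ->.
have /eqP : (1 - u) * cross w (c - h) = 0 by lra.
have /eqP : u * cross w (d - h) = 0 by lra.
rewrite !mulf_eq0 xE (subr_eq0 1 u).
have [dh|/(wgt d ds)/negPf->] := eqVneq d h; last first.
  rewrite orbF => /eqP uE; rewrite uE oner_eq0 /= => /eqP wc.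
  rewrite subr0 scale1r scale0r addr0; apply/eqP/negPn/negP => /(wgt c cs).
  by rewrite wc eqxx.
have [ch|/(wgt c cs)/negPf->] := eqVneq c h; first by rewrite ch dh eqxx in cd.
by move=> _; rewrite orbF => /eqP <-; rewrite subrr scale0r add0r scale1r.
Qed.

(** The common point is [h]; by general position it cannot be interior to [cd]. *)
Lemma head_segment_disjoint p h s c d x :
  uniq [:: p, h & s] ->
  (forall a b r, a \in h :: s -> b \in h :: s -> r \in h :: s ->
    a != b -> b != r -> a != r -> area a b r != 0) ->
  separated_from p (h :: s) -> c \in h :: s -> d \in h :: s -> c != d ->
  segment p h x -> segment c d x -> x \in [:: p; h] /\ x \in [:: c; d].
Proof.
move=> us gp sep cs ds cd px cx.
have xh := separated_segment sep cs ds cd px cx; subst x.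
split; first by rewrite !inE eqxx orbT.
rewrite !inE; apply/norP => -[hc hd].
have := gp c d h cs ds (mem_head _ _) cd; rewrite eq_sym (eq_sym c).
by move=> /(_ hd hc); rewrite area_segment ?eqxx.
Qed.

Lemma gentle_path_plane s a b c d x :
  uniq s -> gentle_path s ->
  (forall a b r, a \in s -> b \in s -> r \in s ->
    a != b -> b != r -> a != r -> area a b r != 0) ->
  infix [:: a; b] s -> infix [:: c; d] s -> (a, b) != (c, d) ->
  segment a b x -> segment c d x -> x \in [:: a; b] /\ x \in [:: c; d].
Proof.
elim: s => [|p [|h s] IH]; rewrite ?infix2_nil // => us gs gp.
have /andP[_ us'] : (p \notin h :: s) && uniq (h :: s) by rewrite -cons_uniq.
have [sep _ gs'] := gs.
have sub y : y \in h :: s -> y \in [:: p, h & s] by rewrite [_ \in p :: _]inE orbC => ->.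
have gp' a' b' r' : a' \in h :: s -> b' \in h :: s -> r' \in h :: s ->
    a' != b' -> b' != r' -> a' != r' -> area a' b' r' != 0.
  by move=> /sub a's /sub b's /sub r's; apply: gp.
have tail y z : infix [:: y; z] (h :: s) -> [/\ y \in h :: s, z \in h :: s & y != z].
  move=> yz; have m := mem_infix yz; have := infix_uniq yz us'.
  by rewrite /= andbT inE => ?; split=> //; apply: m; rewrite !inE eqxx ?orbT.
rewrite !infix2_cons => /orP[/andP[/eqP-> /eqP->]|ab] /orP[/andP[/eqP-> /eqP->]|cd].
- by rewrite eqxx.
- have [cs ds cd'] := tail _ _ cd; move=> _; exact: (head_segment_disjoint us gp' sep).
- have [as_ bs ab'] := tail _ _ ab; move=> _ xab xph.
  by have [] := head_segment_disjoint us gp' sep as_ bs ab' xph xab.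
- exact: IH.
Qed.

Lemma gentle_path_infix s p q r : uniq s -> gentle_path s ->
  infix [:: q; p] s -> infix [:: p; r] s -> gentle q p r.
Proof.
elim: s => [|x [|h s] IH]; rewrite ?infix2_nil // => us [_ g gs].
have /andP[xs us'] : (x \notin h :: s) && uniq (h :: s) by rewrite -cons_uniq.
rewrite !infix2_cons => /orP[/andP[/eqP-> /eqP->]|qp] /orP[/andP[/eqP pE /eqP rE]|pr].
- by rewrite pE mem_head in xs.
- case: s {IH us gs} xs us' g pr => [|y s]; rewrite ?infix2_nil // => _ us' g.
  rewrite infix2_cons => /orP[/andP[_ /eqP->] //|hr].
  by move: us' => /= /andP[/negP[]]; apply: (mem_infix hr); rewrite mem_head.
- case/negP: xs; rewrite -pE; apply: (mem_infix qp); by rewrite !inE eqxx orbT.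
- exact: IH.
Qed.

Lemma ccw_angle_self u : u != 0 -> ccw_angle u u = 0.
Proof.
move=> /dotxx_gt0 u0; rewrite /ccw_angle /enorm -expr2 sqr_sqrtr ?(ltW u0) //.
by rewrite divff ?gt_eqF // acos1 /cross mulrC subrr lexx.
Qed.

(** The cosine of 3 pi / 4 is negative, and its square is 1/2 by the duplication formula, as the
    cosine of 3 pi / 2 is 0. *)
Lemma acos_le_3pi4 (c : R) : -1 <= c <= 1 -> (c < 0 -> c ^+ 2 <= 1 / 2) ->
  acos c <= 3 * pi / 4.
Proof.
move=> c1 c2; rewrite leNgt; apply/negP => ac.
have [/andP[ac0 acpi] cE] := acos_def c1.
have pi0 := pi_gt0 R.
have : cos (acos c) < cos (3 * pi / 4).
  by rewrite ltr_cos // in_itv /=; apply/andP; split; lra.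
rewrite cE => ck.
have k2 : cos (3 * pi / 4 : R) ^+ 2 = 1 / 2.
  have := cos_mulr2n (3 * pi / 4 : R).
  have -> : (3 * pi / 4) *+ 2 = pi / 2 + pi :> R by rewrite mulr2n; lra.
  rewrite cosDpi cos_pihalf oppr0; lra.
have k0 : cos (3 * pi / 4 : R) < 0.
  have -> : 3 * pi / 4 = pi / 4 + pi / 2 :> R by lra.
  rewrite cosDpihalf oppr_lt0; apply: sin_gt0_pi; apply/andP; split; lra.
have := c2 (lt_trans ck k0); nra.
Qed.

(** A negative [cross] makes the counterclockwise angle the reflex one, that is, 2 pi minus a convex
    angle of at most 3 pi / 4. *)
Lemma ccw_angle_gentle u v : cross u v < 0 -> 0 <= dot u v + `|cross u v| ->
  5 * pi / 4 <= ccw_angle u v.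
Proof.
move=> uv g; rewrite /ccw_angle (lt_geF uv).
have u0 : u != 0 by apply: contraTneq uv => ->; rewrite /cross !mul0r subrr ltxx.
have v0 : v != 0 by apply: contraTneq uv => ->; rewrite /cross !mulr0 subrr ltxx.
set N := enorm u * enorm v.
have N0 : 0 < N by rewrite mulr_gt0 // sqrtr_gt0 dotxx_gt0.
have N2 : N ^+ 2 = dot u v ^+ 2 + cross u v ^+ 2.
  rewrite /N /enorm exprMn !sqr_sqrtr ?ltW ?dotxx_gt0 // /dot /cross; ring.
suff : acos (dot u v / N) <= 3 * pi / 4 by lra.
rewrite (ltr0_norm uv) in g.
apply: acos_le_3pi4.
  rewrite ler_pdivrMr // ler_pdivlMr // mul1r mulN1r.
  have := sqr_ge0 (cross u v) => c2; apply/andP; split; nra.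
rewrite pmulr_llt0 ?invr_gt0 // => d0.
rewrite expr_div_n ler_pdivrMr ?exprn_gt0 // N2; nra.
Qed.
End Drawing.

(** * The graph of a gentle path *)

Section Graph.
Variables (R : realType) (S : {fset R * R}) (t : seq S).
Implicit Types p q r : S.

Definition path_graph : rel S :=
  fun p q => infix [:: p; q] t || infix [:: q; p] t.

Hypothesis spans_t : spans S (map val t).
Hypothesis gpS : no_three_collinear S.

Let uniq_t : uniq t.
Proof. by have [] := spans_t; rewrite (map_inj_uniq val_inj). Qed.

Lemma path_graph_sym : symmetric path_graph.
Proof. by move=> p q; rewrite /path_graph orbC. Qed.

Lemma path_graph_neq p q : path_graph p q -> p != q.
Proof.
by move=> /orP[] /infix_uniq/(_ uniq_t); rewrite /= andbT inE // eq_sym.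
Qed.

Lemma path_graph_plane : plane_straight_line_graph path_graph.
Proof.
have [us sS gs] := spans_t.
have gp a b c : a \in map val t -> b \in map val t -> c \in map val t ->
    a != b -> b != c -> a != c -> area a b c != 0.
  by rewrite !sS; apply: gpS.
have plane a b c d x : infix [:: a; b] t -> infix [:: c; d] t -> (a, b) != (c, d) ->
    segment (val a) (val b) x -> segment (val c) (val d) x ->
    x \in [:: val a; val b] /\ x \in [:: val c; val d].
  move=> /(infix_map val) ab /(infix_map val) cd abcd.
  by apply: (gentle_path_plane us gs gp ab cd).
have memC (x y z : R * R) : x \in [:: y; z] -> x \in [:: z; y].
  by rewrite !inE orbC.
split; [exact: path_graph_sym| |].
  by move=> p; apply/negP => /path_graph_neq; rewrite eqxx.
move=> a b c d.
have neq (p q r s : S) : [set p; q]%SET != [set r; s]%SET -> (p, q) != (r, s).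
  by apply: contraNneq => -[-> ->].
move=> /orP[] ab /orP[] cd ne x xab xcd.
- by apply: plane => //; apply: neq.
- have ne' : (a, b) != (d, c) by apply: neq; rewrite (finset.setUC [set d]%SET).
  have [xa xc] := plane a b d c x ab cd ne' xab (segmentC xcd).
  by split=> //; apply: memC.
- have ne' : (b, a) != (c, d) by apply: neq; rewrite (finset.setUC [set b]%SET).
  have [xa xc] := plane b a c d x ab cd ne' (segmentC xab) xcd.
  by split=> //; apply: memC.
- have ne' : (b, a) != (d, c).
    by apply: neq; rewrite (finset.setUC [set b]%SET) (finset.setUC [set d]%SET).
  have [xa xc] := plane b a d c x ab cd ne' (segmentC xab) (segmentC xcd).
  by split; apply: memC.
Qed.

Lemma path_graph_spanning : spanning_path path_graph.
Proof.
have [us sS gs] := spans_t.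
exists t; split=> // p; have := valP p; rewrite -[_ \in S]sS.
by rewrite (mem_map val_inj).
Qed.

Lemma path_graph_neighbors p q r : path_graph p q -> path_graph p r -> q != r ->
  gentle (val q) (val p) (val r) /\
  forall s, path_graph p s -> s = q \/ s = r.
Proof.
have [us sS gs] := spans_t.
wlog pq : q r / infix [:: p; q] t.
  move=> H /[dup] eq /orP[pq|qp] er qr; first exact: H.
  case/orP: (er) => [pr|rp].
    have rq : r != q by rewrite eq_sym.
    have [g n] := H r q pr er eq rq; split; first exact: gentleC.
    by move=> s /n[]; [right|left].
  by case/eqP: qr; apply: infix2_prev_inj qp rp.
move=> _ /orP[pr|rp] qr; first by case/eqP: qr; apply: infix2_next_inj pq pr.
split.
  apply: gentleC; apply: gentle_path_infix us gs _ _; last exact: (infix_map val pq).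
  exact: (infix_map val rp).
move=> s /orP[ps|sp]; first by left; apply: infix2_next_inj ps pq.
by right; apply: infix2_prev_inj sp rp.
Qed.

Lemma path_graph_openness : angle_open (5 * pi / 4) path_graph.
Proof.
have pi0 := pi_gt0 R.
apply: le_bigmin => [|p _]; first lra.
rewrite /vertex_openness; case: leqP => [_|]; first lra.
move=> /card_gt1P[q [r []]]; rewrite !inE => pq pr qr.
have val_neq (a b : S) : a != b -> val a - val b != 0.
  by rewrite subr_eq0 (inj_eq val_inj).
(* General position excludes 0, and exchanging [q] and [r] makes the angle from [q] to [r]
   reflex. *)
wlog qpr : q r pq pr qr / cross (val q - val p) (val r - val p) < 0.
  move=> H; have : area (val p) (val q) (val r) != 0.
    apply: (gpS (valP p) (valP q) (valP r)); rewrite (inj_eq val_inj) //.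
      exact: path_graph_neq pq.
    exact: path_graph_neq pr.
  rewrite neq_lt => /orP[c|c]; first exact: (H q r).
  apply: (H r q) => //; first by rewrite eq_sym.
  by rewrite -oppr_gt0; move: c; rewrite areaE /cross /=; lra.
have [g n] := path_graph_neighbors pq pr qr.
apply: (bigmax_sup (q, r)); last exact: ccw_angle_gentle qpr g.
(* The only edges at [p] are [pq] and [pr], at angle 0 and at the angle itself, so none lies
   strictly between. *)
apply/and4P; split=> //; apply/forallP => s; apply/implyP => /n[->|->].
  rewrite /angle_at ccw_angle_self ?ltxx //; apply: val_neq.
  by rewrite eq_sym path_graph_neq.
by rewrite ltxx andbF.
Qed.
End Graph.

Theorem lemma1 (R : realType) (S : {fset R * R}) :
  S != fset0 -> general_position S ->
  exists e : rel S,
    plane_spanning_path e /\ angle_open (5 * pi / 4) e.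
Proof.
move=> S0 gp.
have gpS : no_three_collinear S.
  move=> p q r pS qS rS pq qr pr; apply: contra_notN (gp p q r pS qS rS pq qr pr).
  rewrite areaE => /eqP col.
  exists (- (q.2 - p.2)), (q.1 - p.1), ((q.1 - p.1) * p.2 - (q.2 - p.2) * p.1); split.
    apply: contraNneq pq => -[/eqP]; rewrite oppr_eq0 => /eqP q2 q1.
    by rewrite -pair_eqE /= eq_sym -subr_eq0 q1 eqxx eq_sym -subr_eq0 q2 eqxx.
  by move=> x; rewrite !inE => /or3P[] /eqP->; lra.
have [s sp] := exists_gentle_spanning_path S0 gpS.
(* All entries of [s] lie in [S], so [insub] drops none of them. *)
pose t : seq S := pmap insub s.
have tE : map val t = s.
  rewrite /t (pmap_filter (@insubK _ _ _)); apply/all_filterP/allP => x.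
  by case: sp => _ -> _ xS; rewrite isSome_insub.
rewrite -tE in sp; exists (path_graph t); split; last exact: path_graph_openness.
by split; [apply: path_graph_plane|apply: path_graph_spanning].
Qed.
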